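(* Let $f$ be a twice differentiable real function on an interval. Clairaut's differential equation $$y = x\,y' + f(y')$$ has the general solution $$y = Cx + f(C),$$ where $C$ is a constant of integration; this general solution is the family of tangent lines to the singular solution. The singular solution is the envelope of the general solution and can be represented parametrically by $$x = -f'(t), \qquad y = f(t) - t f'(t).$$ If $f''(t)\neq 0$, that is, if $f$ is not a linear function, then the singular solution is not included in the general solution, i.e. it is not a member of the family $y=Cx+f(C)$ for any value of $C$.
   Context: The ''general solution'' of Clairaut's equation is its one-parameter family of solutions depending on a constant of integration $C$ (with $C$ in the domain of $f$). The ''singular solution'' is the solution given by the envelope of that family. An envelope of a family of curves is a curve that is tangent to each member of the family and that comprises those points of tangency; when the family consists of lines, the lines are the tangent lines of the envelope. A parametrized curve $(x(t),y(t))$ is a solution of the differential equation when $y(t)=x(t)\,p(t)+f(p(t))$ with $p(t)=\dfrac{dy}{dx}=\dfrac{dy/dt}{dx/dt}$ the slope of the curve at parameter $t$ (at points where $dx/dt\neq 0$). *)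

(* Defs.v *)
From Stdlib Require Import Reals.
Open Scope R_scope.

(* Derivatives are the standard library's [D_in g g' D t]: the difference
   quotients of [g] at [t], taken inside [D], tend to [g' t].  At an endpoint of
   [D] belonging to [D] this is the one-sided derivative, and the values of [g]
   and [g'] outside [D] are irrelevant, so a function on an interval [D] is
   represented by a total function [R -> R]. *)

(* Bounded or not, with or without endpoints, but not empty or a single point. *)
Definition nondegenerate_interval (D : R -> Prop) : Prop :=
  (forall a b x, D a -> D b -> a <= x <= b -> D x) /\
  (exists a b, D a /\ D b /\ a < b).

Definition real_line : R -> Prop := fun _ => True.

Definition affine_on (I : R -> Prop) (f : R -> R) : Prop :=
  exists a b, forall t, I t -> f t = a * t + b.

(* [y], with derivative [y'], satisfies y = x y' + f(y') on [J]; the slopes must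
   lie in the domain [I] of [f]. *)
Definition clairaut_equation (I : R -> Prop) (f : R -> R)
    (J : R -> Prop) (y y' : R -> R) : Prop :=
  forall x, J x ->
    D_in y y' J x /\ I (y' x) /\ y x = x * y' x + f (y' x).

Definition clairaut_solution (I : R -> Prop) (f : R -> R)
    (J : R -> Prop) (y : R -> R) : Prop :=
  exists y', clairaut_equation I f J y y'.

(* Differentiating the equation gives y'' (x + f'(y')) = 0.  The general solution
   is the family obtained by integrating y'' = 0, which is where the constant [C]
   comes from: its members are solutions on the whole line, and each solution
   with y'' = 0 is a member.  It does not contain all solutions: the singular one
   comes from the other factor. *)
Definition general_solution (I : R -> Prop) (f : R -> R)
    (F : R -> R -> R) : Prop :=
  (forall C, I C -> clairaut_solution I f real_line (F C)) /\
  (forall (J : R -> Prop) (y y' : R -> R),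
     nondegenerate_interval J ->
     clairaut_equation I f J y y' ->
     (forall x, J x -> D_in y' (fun _ => 0) J x) ->
     exists C, I C /\ forall x, J x -> y x = F C x).

(* The parametrized curve (X, Y) on [T] solves the equation with slope
   dy/dx = (dY/dt) / (dX/dt), at the parameters where dX/dt <> 0. *)
Definition clairaut_parametric_solution (I : R -> Prop) (f : R -> R)
    (T : R -> Prop) (X Y : R -> R) : Prop :=
  exists X' Y' : R -> R, forall t, T t ->
    D_in X X' T t /\ D_in Y Y' T t /\
    (X' t <> 0 ->
       I (Y' t / X' t) /\ Y t = X t * (Y' t / X' t) + f (Y' t / X' t)).

Definition graph (g : R -> R) (x y : R) : Prop := y = g x.

(* The set [L] is the tangent line of (X, Y) at the regular parameter [t]. *)
Definition tangent_line (T : R -> Prop) (X Y : R -> R) (t : R)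
    (L : R -> R -> Prop) : Prop :=
  exists u v, D_in X (fun _ => u) T t /\ D_in Y (fun _ => v) T t /\
    (u <> 0 \/ v <> 0) /\
    forall x y, L x y <-> exists s, x = X t + s * u /\ y = Y t + s * v.

(* The line [L] passes through (X t, Y t) and contains the velocity direction
   there.  For nonzero velocity this means that [L] is the tangent line; it also
   makes sense at a stationary point of the curve, such as a cusp. *)
Definition touches_line (T : R -> Prop) (X Y : R -> R) (t : R)
    (L : R -> R -> Prop) : Prop :=
  exists u v, D_in X (fun _ => u) T t /\ D_in Y (fun _ => v) T t /\
    forall s, L (X t + s * u) (Y t + s * v).

(* (X, Y), parametrized by the parameter of the family of lines [L], touches the
   member [L C] at the point of parameter [C]: each member is touched, and the
   curve consists of the points of contact. *)
Definition envelope_of_lines (I : R -> Prop) (L : R -> R -> R -> Prop)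
    (X Y : R -> R) : Prop :=
  forall C, I C -> touches_line I X Y C (L C).

(* Main.v *)
Require Import Defs.
From Stdlib Require Import Reals Lra Classical.
Open Scope R_scope.

(** The computation behind everything is that the curve x = - f'(t),
    y = f(t) - t f'(t) has velocity (- f''(t), - t f''(t)): wherever it moves,
    it moves with slope t.  Since its point of parameter t satisfies
    y = t x + f(t), it solves the equation and touches the line of slope t of
    the family there.  Conversely, let a curve (X0, Y0) touch the line of
    parameter C at its own parameter C, for every C.  Differentiating the
    incidence relation Y0 = C X0 + f(C) in C and subtracting the tangency
    relation Y0' = C X0' leaves X0 = - f'(C): the envelope is determined.

    The rest depends on recovering a function from a vanishing derivative
    ([eq_of_zero_derivative_off_point]).  If y' has derivative zero, it is a
    constant C, and the equation then reads y = C x + f(C).  If f'' is zero, f'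
    is constant and f is affine.  If the singular solution lies on the line of
    parameter C, differentiating along that line gives (t - C) f''(t) = 0, so f''
    vanishes except possibly at C; as f'' need not be continuous, the value
    f''(C) needs an argument.  The mean value theorem only looks at derivatives
    strictly between two points, so f' is still constant, and then f''(C) = 0
    too.

    Derivatives are relative to an interval that may contain its endpoints.
    They are unique there because no point of a nondegenerate interval is
    isolated in it. *)

(** * Derivatives relative to a set *)

Lemma D_in_ext (D : R -> Prop) (g h g' h' : R -> R) (t : R) :
  D t -> (forall x, D x -> g x = h x) -> g' t = h' t ->
  D_in g g' D t -> D_in h h' D t.
Proof.
  intros Ht Hgh Hd H eps Heps.
  destruct (H eps Heps) as [alp [Halp Hlim]].
  exists alp; split; [exact Halp|].
  intros x [[Hx Hne] Hdist].
  rewrite <- Hd, <- (Hgh x Hx), <- (Hgh t Ht).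
  apply Hlim; repeat split; assumption.
Qed.

Lemma nondegenerate_interval_accumulation (I : R -> Prop) (t : R) :
  nondegenerate_interval I -> I t -> adhDa (D_x I t) t.
Proof.
  intros [Hconv [a [b [Ha [Hb Hab]]]]] Ht alp Halp.
  destruct (Rlt_le_dec t b) as [Htb|Hbt].
  - exists (t + Rmin (alp / 2) (b - t)).
    assert (H1 := Rmin_l (alp / 2) (b - t)).
    assert (H2 := Rmin_r (alp / 2) (b - t)).
    assert (H3 : 0 < Rmin (alp / 2) (b - t)) by (apply Rmin_pos; lra).
    repeat split; try lra.
    + apply (Hconv t b); auto; lra.
    + unfold Rdist. rewrite Rabs_right; lra.
  - exists (t - Rmin (alp / 2) (t - a)).
    assert (H1 := Rmin_l (alp / 2) (t - a)).
    assert (H2 := Rmin_r (alp / 2) (t - a)).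
    assert (H3 : 0 < Rmin (alp / 2) (t - a)) by (apply Rmin_pos; lra).
    repeat split; try lra.
    + apply (Hconv a t); auto; lra.
    + unfold Rdist. rewrite Rabs_left; lra.
Qed.

Lemma D_in_unique (I : R -> Prop) (g h g' h' : R -> R) (t : R) :
  nondegenerate_interval I -> I t -> (forall x, I x -> g x = h x) ->
  D_in g g' I t -> D_in h h' I t -> g' t = h' t.
Proof.
  intros HI Ht Hgh Hg Hh.
  apply (single_limit (fun x => (h x - h t) / (x - t)) (D_x I t) _ _ t).
  - exact (nondegenerate_interval_accumulation I t HI Ht).
  - exact (D_in_ext I g h g' g' t Ht Hgh eq_refl Hg).
  - exact Hh.
Qed.

Lemma D_in_line (D : R -> Prop) (g g' : R -> R) (C k t : R) :
  D_in g g' D t -> D_in (fun x => C * g x + k) (fun x => C * g' x) D t.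
Proof.
  intros Hg eps Heps.
  destruct (Dmult_const D g g' t C Hg eps Heps) as [alp [Halp Hlim]].
  exists alp; split; [exact Halp|].
  intros x Hx.
  replace (C * g x + k - (C * g t + k)) with (C * g x - C * g t) by ring.
  exact (Hlim x Hx).
Qed.

(** * Functions with vanishing derivative on an interval *)

(** The mean value theorem for two-sided derivatives does not apply to [g]
    itself: [a] and [b] may be endpoints of [I], beyond which [g] is arbitrary.
    It is applied instead to the extension of [g] from [[a, b]] by constants,
    which is continuous at [a] and [b] as well. *)
Lemma eq_of_zero_derivative_between (I : R -> Prop) (g g' : R -> R) (a b : R) :
  a < b ->
  (forall t, a <= t <= b -> I t) ->
  (forall t, a <= t <= b -> D_in g g' I t) ->
  (forall t, a < t < b -> g' t = 0) ->
  g a = g b.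
Proof.
  intros Hab HI Hg H0.
  set (clamp := fun x => Rmax a (Rmin b x)).
  assert (clamp_in : forall x, a <= clamp x <= b).
  { intros x; unfold clamp, Rmax, Rmin; repeat destruct Rle_dec; lra. }
  assert (clamp_id : forall x, a <= x <= b -> clamp x = x).
  { intros x Hx; unfold clamp, Rmax, Rmin; repeat destruct Rle_dec; lra. }
  assert (clamp_near : forall x t, a <= t <= b ->
            Rabs (clamp x - t) <= Rabs (x - t)).
  { intros x t Ht; unfold clamp, Rmax, Rmin, Rabs;
      repeat destruct Rle_dec; repeat destruct Rcase_abs; lra. }
  set (h := fun x => g (clamp x)).
  assert (Hcont : forall t, a <= t <= b -> continuity_pt h t).
  { intros t Ht eps Heps.
    destruct (cont_deriv g g' I t (Hg t Ht) eps Heps) as [alp [Halp Hlim]].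
    exists alp; split; [exact Halp|].
    intros x [_ Hx]; unfold h; rewrite (clamp_id t Ht).
    destruct (Req_dec t (clamp x)) as [E|Hne].
    - rewrite <- E; simpl; unfold Rdist; rewrite Rminus_diag, Rabs_R0; exact Heps.
    - apply Hlim; repeat split; auto.
      simpl in *; unfold Rdist in *.
      eapply Rle_lt_trans; [exact (clamp_near x t Ht)|exact Hx]. }
  assert (Hder : forall t, a < t < b -> derivable_pt_lim h t 0).
  { intros t Ht eps Heps.
    assert (Ht' : a <= t <= b) by lra.
    destruct (Hg t Ht' eps Heps) as [alp [Halp Hlim]].
    assert (Hd : 0 < Rmin alp (Rmin (t - a) (b - t)))
      by (repeat apply Rmin_pos; lra).
    exists (mkposreal _ Hd); simpl; intros k Hk Hsmall.
    assert (H1 := Rmin_l alp (Rmin (t - a) (b - t))).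
    assert (H2 := Rmin_r alp (Rmin (t - a) (b - t))).
    assert (H3 := Rmin_l (t - a) (b - t)).
    assert (H4 := Rmin_r (t - a) (b - t)).
    assert (Hin : a <= t + k <= b)
      by (unfold Rabs in Hsmall; destruct Rcase_abs; lra).
    unfold h; rewrite (clamp_id t Ht'), (clamp_id (t + k) Hin).
    specialize (Hlim (t + k)); simpl in Hlim; unfold Rdist in Hlim.
    rewrite (H0 t Ht) in Hlim.
    replace (t + k - t) with k in Hlim by ring.
    apply Hlim; repeat split; auto; lra. }
  assert (Hconst : constant_D_eq h (fun x => a <= x <= b) (h a)).
  { apply (null_derivative_loc h a b
             (fun t Ht => exist _ 0 (Hder t Ht))); [exact Hcont|].
    intros t Ht; reflexivity. }
  assert (E := Hconst b); unfold h in E.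
  rewrite !clamp_id in E by lra.
  symmetry; apply E; lra.
Qed.

(** One exceptional point [c] is harmless: it is an end of every segment that the
    mean value theorem is used on. *)
Lemma eq_of_zero_derivative_off_point (I : R -> Prop) (g g' : R -> R) (c : R) :
  nondegenerate_interval I -> I c ->
  (forall t, I t -> D_in g g' I t) ->
  (forall t, I t -> t <> c -> g' t = 0) ->
  forall t, I t -> g t = g c.
Proof.
  intros [Hconv _] Hc Hg H0 t Ht.
  assert (Hseg : forall a b, I a -> I b -> a < b -> a = c \/ b = c -> g a = g b).
  { intros a b Ha Hb Hab Hend.
    assert (HI : forall x, a <= x <= b -> I x)
      by (intros x Hx; exact (Hconv a b x Ha Hb Hx)).
    apply (eq_of_zero_derivative_between I g g' a b Hab HI).
    - intros x Hx; apply Hg, HI; exact Hx.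
    - intros x Hx; apply H0; [apply HI|]; lra. }
  destruct (Rtotal_order t c) as [Hlt|[->|Hgt]]; auto.
  symmetry; auto.
Qed.

Lemma zero_derivative_of_eq_const (I : R -> Prop) (g g' : R -> R) (k : R) :
  nondegenerate_interval I ->
  (forall t, I t -> D_in g g' I t) ->
  (forall t, I t -> g t = k) ->
  forall t, I t -> g' t = 0.
Proof.
  intros HI Hg Hk t Ht.
  exact (D_in_unique I g (fun _ => k) g' (fun _ => 0) t HI Ht Hk (Hg t Ht)
           (Dconst I k t)).
Qed.

Lemma affine_on_iff_second_derivative_zero (I : R -> Prop) (f f' f'' : R -> R) :
  nondegenerate_interval I ->
  (forall t, I t -> D_in f f' I t) ->
  (forall t, I t -> D_in f' f'' I t) ->
  affine_on I f <-> (forall t, I t -> f'' t = 0).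
Proof.
  intros HI hf' hf''; split.
  - intros [a [b Hf]].
    apply (zero_derivative_of_eq_const I f' f'' a HI hf'').
    intros t Ht.
    apply (D_in_unique I f (fun x => a * x + b) f' (fun _ => a) t HI Ht Hf
             (hf' t Ht)).
    apply (D_in_ext I _ _ (fun _ => a * 1) _ t Ht (fun x _ => eq_refl));
      [ring|].
    exact (D_in_line I _ _ a b t (Dx I t)).
  - intros H0.
    pose proof HI as [_ [c [_ [Hc _]]]].
    assert (Hf'c := eq_of_zero_derivative_off_point I f' f'' c HI Hc hf''
                      (fun t Ht _ => H0 t Ht)).
    assert (Hfc : forall t, I t -> f t - f' c * t = f c - f' c * c).
    { apply (eq_of_zero_derivative_off_point I (fun t => f t - f' c * t)
               (fun t => f' t - f' c * 1) c HI Hc).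
      - intros t Ht.
        exact (Dminus I _ _ _ _ t (hf' t Ht)
                 (Dmult_const I _ _ t (f' c) (Dx I t))).
      - intros t Ht _; rewrite (Hf'c t Ht); ring. }
    exists (f' c), (f c - f' c * c).
    intros t Ht; rewrite <- (Hfc t Ht); ring.
Qed.

(** * Clairaut's equation *)

Lemma clairaut_general_solution (I : R -> Prop) (f : R -> R) :
  general_solution I f (fun C x => C * x + f C).
Proof.
  split.
  - intros C HC; exists (fun _ => C * 1); intros x _; split; [|split].
    + exact (D_in_line _ _ _ C (f C) x (Dx real_line x)).
    + rewrite Rmult_1_r; exact HC.
    + rewrite Rmult_1_r; ring.
  - intros J y y' HJ Heq H0.
    pose proof HJ as [_ [c [_ [Hc _]]]].
    assert (Hy' := eq_of_zero_derivative_off_point J y' (fun _ => 0) c HJ Hc H0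
                     (fun _ _ _ => eq_refl)).
    exists (y' c); split; [apply Heq; exact Hc|].
    intros x Hx.
    destruct (Heq x Hx) as [_ [_ Hyx]].
    rewrite Hyx, (Hy' x Hx); ring.
Qed.

Lemma D_in_singular_abscissa (I : R -> Prop) (f' f'' : R -> R) (t : R) :
  D_in f' f'' I t -> D_in (fun s => - f' s) (fun s => - f'' s) I t.
Proof. exact (Dopp I f' f'' t). Qed.

(** The two terms in f' produced by f and by t f' cancel, which is why the
    velocity (- f'', - t f'') has slope t. *)
Lemma D_in_singular_ordinate (I : R -> Prop) (f f' f'' : R -> R) (t : R) :
  I t -> D_in f f' I t -> D_in f' f'' I t ->
  D_in (fun s => f s - s * f' s) (fun s => - (s * f'' s)) I t.
Proof.
  intros Ht Hf Hf'.
  apply (D_in_ext I _ _ (fun s => f' s - (1 * f' s + s * f'' s)) _ t Ht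
           (fun s _ => eq_refl)); [ring|].
  exact (Dminus I _ _ _ _ t Hf (Dmult I _ _ _ _ t (Dx I t) Hf')).
Qed.

Lemma singular_curve_solution (I : R -> Prop) (f f' f'' : R -> R) :
  (forall t, I t -> D_in f f' I t) ->
  (forall t, I t -> D_in f' f'' I t) ->
  clairaut_parametric_solution I f I (fun t => - f' t) (fun t => f t - t * f' t).
Proof.
  intros hf' hf''.
  exists (fun t => - f'' t), (fun t => - (t * f'' t)); intros t Ht.
  split; [|split].
  - exact (D_in_singular_abscissa I f' f'' t (hf'' t Ht)).
  - exact (D_in_singular_ordinate I f f' f'' t Ht (hf' t Ht) (hf'' t Ht)).
  - intros Hne.
    replace (- (t * f'' t) / - f'' t) with t by (field; lra).
    split; [exact Ht|ring].
Qed.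

(** Let the curve have velocity (u, v) at its contact point with the line of
    parameter C.  The incidence relation Y0 = C X0 + f(C), differentiated in C,
    gives v = X0 + C u + f'(C), while tangency says v = C u. *)
Lemma envelope_of_lines_iff_singular_curve (I : R -> Prop) (f f' f'' : R -> R)
    (X0 Y0 : R -> R) :
  nondegenerate_interval I ->
  (forall t, I t -> D_in f f' I t) ->
  (forall t, I t -> D_in f' f'' I t) ->
  envelope_of_lines I (fun C => graph (fun x => C * x + f C)) X0 Y0 <->
  (forall t, I t -> X0 t = - f' t /\ Y0 t = f t - t * f' t).
Proof.
  intros HI hf' hf''; split.
  - intros Henv.
    assert (Hinc : forall t, I t -> Y0 t = t * X0 t + f t).
    { intros t Ht; destruct (Henv t Ht) as [u [v [_ [_ HL]]]].
      specialize (HL 0); unfold graph in HL.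
      rewrite !Rmult_0_l, !Rplus_0_r in HL; exact HL. }
    intros t Ht; destruct (Henv t Ht) as [u [v [HX [HY HL]]]].
    assert (Htan : v = t * u)
      by (specialize (HL 1); unfold graph in HL; rewrite (Hinc t Ht) in HL; lra).
    assert (Hdiff : v = 1 * X0 t + t * u + f' t).
    { exact (D_in_unique I Y0 (fun s => s * X0 s + f s)
               (fun _ => v) (fun s => 1 * X0 s + s * u + f' s) t HI Ht Hinc HY
               (Dadd I _ _ _ _ t (Dmult I _ _ _ _ t (Dx I t) HX) (hf' t Ht))). }
    assert (E : X0 t = - f' t) by lra.
    split; [exact E|].
    rewrite (Hinc t Ht), E; ring.
  - intros HXY C HC.
    exists (- f'' C), (- (C * f'' C)); split; [|split].
    + apply (D_in_ext I (fun s => - f' s) X0 (fun s => - f'' s) _ C HC);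
        [|reflexivity|exact (D_in_singular_abscissa I f' f'' C (hf'' C HC))].
      intros s Hs; symmetry; apply HXY; exact Hs.
    + apply (D_in_ext I (fun s => f s - s * f' s) Y0 (fun s => - (s * f'' s)) _ C HC);
        [|reflexivity
         |exact (D_in_singular_ordinate I f f' f'' C HC (hf' C HC) (hf'' C HC))].
      intros s Hs; symmetry; apply HXY; exact Hs.
    + intros s; destruct (HXY C HC) as [-> ->]; unfold graph; ring.
Qed.

Lemma singular_curve_tangent_line (I : R -> Prop) (f f' f'' : R -> R) (t : R) :
  I t -> D_in f f' I t -> D_in f' f'' I t -> f'' t <> 0 ->
  tangent_line I (fun s => - f' s) (fun s => f s - s * f' s) t
    (graph (fun x => t * x + f t)).
Proof.
  intros Ht Hf Hf' Hne.
  exists (- f'' t), (- (t * f'' t)); split; [|split; [|split]].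
  - apply (D_in_ext I (fun s => - f' s) _ (fun s => - f'' s) _ t Ht
             (fun s _ => eq_refl) eq_refl).
    exact (D_in_singular_abscissa I f' f'' t Hf').
  - apply (D_in_ext I (fun s => f s - s * f' s) _ (fun s => - (s * f'' s)) _ t Ht
             (fun s _ => eq_refl) eq_refl).
    exact (D_in_singular_ordinate I f f' f'' t Ht Hf Hf').
  - left; lra.
  - intros x y; unfold graph; split.
    + intros ->; exists (- (x + f' t) / f'' t); split; field; exact Hne.
    + intros [s [-> ->]]; ring.
Qed.

(** Differentiating the relation Y = C X + f(C) along the singular curve gives
    - t f'' = - C f'', so f'' vanishes off C.  Then f' is constant on all of I,
    and f'' vanishes at C as well. *)
Lemma second_derivative_zero_of_singular_curve_on_line
    (I : R -> Prop) (f f' f'' : R -> R) (C : R) :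
  nondegenerate_interval I ->
  (forall t, I t -> D_in f f' I t) ->
  (forall t, I t -> D_in f' f'' I t) ->
  I C ->
  (forall t, I t -> f t - t * f' t = C * - f' t + f C) ->
  forall t, I t -> f'' t = 0.
Proof.
  intros HI hf' hf'' HC Hline.
  assert (Hoff : forall t, I t -> t <> C -> f'' t = 0).
  { intros t Ht Hne.
    assert (Hdiff : - (t * f'' t) = C * - f'' t).
    { exact (D_in_unique I _ _ _ _ t HI Ht Hline
               (D_in_singular_ordinate I f f' f'' t Ht (hf' t Ht) (hf'' t Ht))
               (D_in_line I _ _ C (f C) t
                  (D_in_singular_abscissa I f' f'' t (hf'' t Ht)))). }
    apply (Rmult_eq_reg_l (t - C)); lra. }
  apply (zero_derivative_of_eq_const I f' f'' (f' C) HI hf'').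
  exact (eq_of_zero_derivative_off_point I f' f'' C HI HC hf'' Hoff).
Qed.

Theorem theorem6p2
  (I : R -> Prop) (f f' f'' : R -> R)
  (hI : nondegenerate_interval I)
  (hf' : forall t, I t -> D_in f f' I t)
  (hf'' : forall t, I t -> D_in f' f'' I t) :
  let F := fun C x : R => C * x + f C in
  let X := fun t : R => - f' t in
  let Y := fun t : R => f t - t * f' t in
  general_solution I f F /\
  clairaut_parametric_solution I f I X Y /\
  (forall X0 Y0 : R -> R,
     envelope_of_lines I (fun C => graph (F C)) X0 Y0 <->
     (forall t, I t -> X0 t = X t /\ Y0 t = Y t)) /\
  (forall t, I t -> f'' t <> 0 -> tangent_line I X Y t (graph (F t))) /\
  ((exists t, I t /\ f'' t <> 0) <-> ~ affine_on I f) /\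
  ((exists t, I t /\ f'' t <> 0) ->
     forall C, I C -> ~ (forall t, I t -> graph (F C) (X t) (Y t))).
Proof.
  intros F X Y.
  split; [|split; [|split; [|split; [|split]]]].
  - exact (clairaut_general_solution I f).
  - exact (singular_curve_solution I f f' f'' hf' hf'').
  - intros X0 Y0.
    exact (envelope_of_lines_iff_singular_curve I f f' f'' X0 Y0 hI hf' hf'').
  - intros t Ht.
    exact (singular_curve_tangent_line I f f' f'' t Ht (hf' t Ht) (hf'' t Ht)).
  - rewrite (affine_on_iff_second_derivative_zero I f f' f'' hI hf' hf''); split.
    + intros [t [Ht Hne]] H0; exact (Hne (H0 t Ht)).
    + intros Hn; apply NNPP; intros Hnone; apply Hn; intros t Ht.
      apply NNPP; intros Hne; apply Hnone; exists t; split; assumption.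
  - intros [t [Ht Hne]] C HC Hline; apply Hne.
    exact (second_derivative_zero_of_singular_curve_on_line
             I f f' f'' C hI hf' hf'' HC Hline t Ht).
Qed.
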